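(* If $G$ is a Halin graph, then $\mathrm{pind}(A_G)=1$, and hence $G$ is $(2,2)$-choosable.
   Context: Graphs are finite and simple. A Halin graph is a planar graph obtained from a plane tree (an embedding of a tree in the plane) without vertices of degree $2$ by adding a cycle connecting the leaves of the tree cyclically (in the cyclic order given by the embedding). The matrix $A_G$: fix an orientation of $G$. $A_G$ is the real matrix with rows indexed by $E(G)$ and columns indexed by $V(G)\cup E(G)$, where for an edge $e$ oriented from $a$ to $b$: $A_G[e,z]=1$ if $z=b$ or $z\neq e$ is an edge incident to $b$; $A_G[e,z]=-1$ if $z=a$ or $z\ne e$ is an edge incident to $a$; and $A_G[e,z]=0$ otherwise. (Changing the orientation only multiplies rows by $-1$, so the notion below does not depend on it.) The permanent of an $m\times m$ matrix $A$ is $\mathrm{per}(A)=\sum_{\sigma\in S_m}\prod_{i=1}^m A[i,\sigma(i)]$. The permanent index $\mathrm{pind}(A)$ of a matrix $A$ is the minimum integer $k$ such that there is a square matrix $A'$ (with the same rows as $A$) with $\mathrm{per}(A')\ne0$, each column of $A'$ is a column of $A$, and each column of $A$ (identified by its column index) occurs in $A'$ at most $k$ times; if no such $k$ exists, $\mathrm{pind}(A)=\infty$. A total weighting of $G$ is a map $f:V(G)\cup E(G)\to\mathbb{R}$; the vertex sum of $v$ is $\phi_f(v)=f(v)+\sum_{e\in E(v)}f(e)$, where $E(v)$ is the set of edges incident to $v$. It is proper if $\phi_f(u)\neq\phi_f(v)$ for every edge $uv$ of $G$. $G$ is $(k,k')$-choosable if for every assignment $L$ of a set $L(v)$ of $k$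 real numbers to each vertex $v$ and a set $L(e)$ of $k'$ real numbers to each edge $e$, there is a proper total weighting $f$ with $f(z)\in L(z)$ for all $z\in V(G)\cup E(G)$. *)

(* Defs.v *)
From mathcomp Require Import all_boot all_order all_fingroup all_algebra.
From mathcomp Require Import finmap.
From mathcomp Require Import boolp reals.

Set Implicit Arguments.
Unset Strict Implicit.
Unset Printing Implicit Defensive.

Import GRing.Theory.
Local Open Scope ring_scope.

Record sgraph (T : finType) := SGraph {
  adj :> rel T;
  adj_sym : symmetric adj;
  adj_irr : irreflexive adj
}.

Section Graphs.
Variables (T : finType) (G : sgraph T).

Definition nbr (v : T) : {set T} := [set u | G v u].

Definition leaf (v : T) : bool := #|nbr v| == 1%N.

Definition edges : {set {set T}} :=
  [set [set p.1; p.2] | p : T * T & G p.1 p.2].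

Definition is_tree : Prop :=
  (forall x y, connect G x y) /\
  ~ (exists2 c : seq T, (2 < size c)%N & ucycle G c).

End Graphs.

Notation edge G := {e : {set _} | e \in edges G}.

(* A plane tree is a tree with a rotation system: [rho v] cyclically permutes *)
(* the neighbours of [v] in the order in which their edges leave [v] in the   *)
(* embedding. Every rotation system of a tree comes from an embedding in the  *)
(* plane. The values of [rho v] outside [nbr t v] are irrelevant.             *)
Definition rotation_system (T : finType) (t : sgraph T) (rho : T -> {perm T}) :
    Prop :=
  forall v u, t v u -> porbit (rho v) u = nbr t v.

(* Walking along the boundary of a face: having traversed the edge from       *)
(* [d.1] to [d.2], leave [d.2] by the edge that follows in the rotation.      *)
Definition face_step (T : finType) (rho : T -> {perm T}) (d : T * T) : T * T :=
  (d.2, rho d.2 d.1).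

(* The leaves in their cyclic order in the embedding. A plane tree has only   *)
(* one face, so the boundary walk from the directed edge [d] traverses every  *)
(* directed edge of [t] once and meets each leaf once; another choice of [d]  *)
(* rotates the list.                                                          *)
Definition leaf_order (T : finType) (t : sgraph T) (rho : T -> {perm T})
    (d : T * T) : seq T :=
  [seq x.1 | x <- fingraph.orbit (face_step rho) d & leaf t x.1].

Definition cycle_adj (T : eqType) (c : seq T) (u v : T) : bool :=
  [&& u \in c, v \in c & (next c u == v) || (next c v == u)].

(* As graphs are simple, the added cycle has at least three vertices; this    *)
(* excludes the one-edge tree.                                                *)
Definition halin (T : finType) (G : sgraph T) : Prop :=
  exists (t : sgraph T) (rho : T -> {perm T}) (d : T * T),
    [/\ is_tree t,
        forall v, #|nbr t v| != 2%N,
        rotation_system t rho,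
        t d.1 d.2 &
        let c := leaf_order t rho d in
        (2 < size c)%N /\ (forall u v, G u v = t u v || cycle_adj c u v)].

Record orientation (T : finType) (G : sgraph T) := Orientation {
  arc_tail : edge G -> T;
  arc_head : edge G -> T;
  orientationP : forall e, val e = [set arc_tail e; arc_head e]
}.

(* Whether [z] is the vertex [v], or an edge other than [e] incident to [v].  *)
Definition meets (T : finType) (G : sgraph T) (e : edge G) (v : T)
    (z : T + edge G) : bool :=
  match z with
  | inl u => u == v
  | inr f => (f != e) && (v \in val f)
  end.

Definition A_entry (R : realType) (T : finType) (G : sgraph T)
    (o : orientation G) (e : edge G) (z : T + edge G) : R :=
  if meets e (arc_head o e) z then 1
  else if meets e (arc_tail o e) z then -1
  else 0.

Definition A_mx (R : realType) (T : finType) (G : sgraph T)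
    (o : orientation G) : 'M[R]_(#|{: edge G}|, #|{: T + edge G}|) :=
  \matrix_(i, j) A_entry R o (enum_val i) (enum_val j).

Definition per (R : realType) (m : nat) (A : 'M[R]_m) : R :=
  \sum_(s : 'S_m) \prod_(i < m) A i (s i).

(* The square matrix is [colsub s A], whose [i]-th column is the column of    *)
(* index [s i] of [A].                                                        *)
Definition pind_le (R : realType) (m n : nat) (A : 'M[R]_(m, n)) (k : nat) :
    bool :=
  [exists s : {ffun 'I_m -> 'I_n},
    (per (colsub s A) != 0) && [forall j, #|[set i | s i == j]| <= k]%N].

(* [None] stands for infinity. *)
Definition pind (R : realType) (m n : nat) (A : 'M[R]_(m, n)) : option nat :=
  match pselect (exists k, pind_le A k) with
  | left exk => Some (ex_minn exk)
  | right _ => None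
  end.

Definition vertex_sum (R : realType) (T : finType) (G : sgraph T)
    (f : T + edge G -> R) (v : T) : R :=
  f (inl v) + \sum_(e : edge G | v \in val e) f (inr e).

Definition proper_weighting (R : realType) (T : finType) (G : sgraph T)
    (f : T + edge G -> R) : Prop :=
  forall u v, G u v -> vertex_sum f u <> vertex_sum f v.

Definition choosable (R : realType) (T : finType) (G : sgraph T)
    (k k' : nat) : Prop :=
  forall L : T + edge G -> {fset R},
    (forall v : T, #|` L (inl v)| = k) ->
    (forall e : edge G, #|` L (inr e)| = k') ->
    exists2 f : T + edge G -> R,
      proper_weighting f & forall z, f z \in L z.

(* Main.v *)
Require Import Defs.
From mathcomp Require Import all_boot all_order all_fingroup all_algebra.
From mathcomp Require Import reals.
From mathcomp Require Import boolp finmap mpoly ring lra.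

(* Give each vertex v a variable X_v; the column of A_G indexed by z becomes  *)
(* the linear form X_v (z = v) or X_u + X_v (z = uv), and the row of an edge  *)
(* the derivation D_u - D_v. The permanent of chosen columns is then the      *)
(* result of applying all edge derivations to the product of their forms.     *)
(* Let a_0 ... a_n be the cycle through the leaves of the tree and w the tree *)
(* neighbour of a_n. Choose all vertices except w, the edges a_i a_{i+1} for  *)
(* i < n, and either the edge a_n w or the vertex w. The two permanents       *)
(* differ by the one where the last column is replaced by a copy of a_n, so   *)
(* it suffices that the latter is nonzero. There, applying the tree edges     *)
(* from the root w outwards removes the variables of all vertices off the     *)
(* cycle and leaves D_{a_i} for each i. Eliminating a_0, a_1, ... one after   *)
(* the other gives a number of absolute value < 2^(n+1), from the term D_{a_n}*)
(* of the derivation D_{a_n} - D_{a_0} of the closing edge, minus             *)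
(* 2 (-2)^n from the other term; hence the permanent is nonzero.              *)
(* Choosability follows from an alternating sum over the corners of a box,    *)
(* which is the permanent up to a nonzero factor.                             *)

(** The Leibniz rule for an edge derivation reproduces the expansion of a permanent along a row
    ([per_ediff]), so the task is to find distinct columns whose product of forms is not killed by
    the edge derivations. With y = a_n, the identity X_y = (X_y + X_w) - X_w writes a product
    containing X_y twice as a difference of two products of distinct columns; if the former is not
    killed, neither are both of the latter ([halin_columns]).

    For the product with X_y twice, peeling off the tree ([ediffs_tree]) leaves a computation on the
    cycle. Eliminating one vertex acts on a pair of numbers by a matrix whose square is -2 times the
    identity, so one term of the closing edge has size of order 2^(n/2) ([path_diff2_lt]), whereas
    the other is exactly 2 (-2)^n ([path_diff1E]). They cannot cancel ([path_diff_neq0]).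

    Choosability is an explicit Combinatorial Nullstellensatz: by [alternating_sum_per], a nonzero
    permanent forces some choice between two values per chosen column to make all edge differences
    nonzero ([per_neq0_choice], [choosable22]). *)

Set Implicit Arguments.
Unset Strict Implicit.
Unset Printing Implicit Defensive.

Import Order.TTheory GRing.Theory Num.Theory.
Local Open Scope ring_scope.

(** * Permanents as iterated derivatives *)

Lemma perm_lift0_bij m (j : 'I_m.+1) :
  {on [pred s : 'S_m.+1 | s ord0 == j], bijective (lift_perm ord0 j)}.
Proof.
pose f (s : 'S_m.+1) k := odflt k (unlift (s ord0) (s (lift ord0 k))).
have fK (s : 'S_m.+1) k : lift (s ord0) (f s k) = s (lift ord0 k).
  rewrite /f; have := neq_lift ord0 k.
  by rewrite -(can_eq (permK s)) => /unlift_some[] ? ? ->.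
have f_inj (s : 'S_m.+1) : injective (f s).
  move=> k k' /(congr1 (lift (s ord0))).
  by rewrite !fK => /perm_inj/lift_inj.
exists (fun s => perm (f_inj s)) => [s _ | s].
  by apply/permP => k; rewrite permE /f lift_perm_lift lift_perm_id liftK.
rewrite inE => /eqP sj; apply/permP => k.
case: (unliftP ord0 k) => [k'|] ->; last by rewrite lift_perm_id sj.
by rewrite lift_perm_lift permE -sj fK.
Qed.

Lemma per_expand_row0 (R : realType) m (A : 'M[R]_m.+1) :
  per A = \sum_j A ord0 j * per (row' ord0 (col' j A)).
Proof.
rewrite /per (partition_big (fun s : 'S_m.+1 => s ord0) predT) //=.
apply: eq_bigr => j _; rewrite (reindex _ (perm_lift0_bij j)) big_distrr /=.
apply: eq_big => [s | s _]; first by rewrite lift_perm_id eqxx.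
rewrite big_ord_recl lift_perm_id; congr (_ * _).
by apply: eq_bigr => i _; rewrite lift_perm_lift !mxE.
Qed.

Section Derivations.
Variables (R : realType) (T : finType).
Local Notation A := {mpoly R[#|T|]}.
Implicit Types (p q : A) (e : T * T) (l : seq (T * T)).

Definition pvar (v : T) : A := 'X_(enum_rank v).

Local Notation D v := (mderiv (enum_rank v)).

Definition ediff e p : A := D e.1 p - D e.2 p.

Definition ediffs l p : A := foldl (fun q e => ediff e q) p l.

Lemma deriv_pvar u v : D u (pvar v) = (u == v)%:R.
Proof.
rewrite /pvar mderivX mnm1E (inj_eq enum_rank_inj) eq_sym.
case: eqP => [->|_]; last by rewrite scale0r.
by rewrite scale1r -{1}[U_(_)%MM]add0m addmK mpolyX0.
Qed.

Lemma ediffM e p q : ediff e (p * q) = ediff e p * q + p * ediff e q.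
Proof.
by rewrite /ediff !mderivM mulrBr mulrBl opprD !addrA; congr (_ - _); rewrite addrAC.
Qed.

Lemma ediffD e p q : ediff e (p + q) = ediff e p + ediff e q.
Proof. by rewrite /ediff !mderivD opprD addrACA. Qed.

Lemma ediffZ e c p : ediff e (c *: p) = c *: ediff e p.
Proof. by rewrite /ediff !mderivZ scalerBr. Qed.

Lemma ediff_sum (I : Type) (r : seq I) (F : I -> A) e :
  ediff e (\sum_(i <- r) F i) = \sum_(i <- r) ediff e (F i).
Proof.
apply: (big_morph (ediff e)) => [p q|]; first exact: ediffD.
by rewrite /ediff !mderiv0 subrr.
Qed.

Lemma ediff_prod m (F : 'I_m.+1 -> A) e :
  ediff e (\prod_i F i) = \sum_j ediff e (F j) * \prod_i F (lift j i).
Proof.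
elim: m F => [|m IHm] F; first by rewrite !big_ord1 !big_ord0 mulr1.
rewrite big_ord_recl ediffM [RHS]big_ord_recl IHm; congr (_ + _).
rewrite big_distrr /=; apply: eq_bigr => j _.
rewrite mulrCA; congr (_ * _); rewrite [RHS]big_ord_recl /=; congr (F _ * _).
  by apply: val_inj.
by apply: eq_bigr => i _; congr F; apply: val_inj; rewrite /= /bump !leq0n !add1n ltnS addnS.
Qed.

(** The first derivation hits each factor in turn; the resulting constants pull out of the later
    derivations, which is the expansion along row 0. *)
Lemma per_ediff m (M : 'M[R]_m) (es : 'I_m -> T * T) (c : 'I_m -> A) :
    (forall i j, ediff (es i) (c j) = (M i j)%:MP) ->
  ediffs [seq es i | i <- enum 'I_m] (\prod_j c j) = (per M)%:MP.
Proof.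
elim: m M es c => [|m IHm] M es c Mc.
  rewrite /ediffs (eq_enum (B := pred0)); last by case.
  rewrite enum0 /= big_ord0 /per (big_pred1 1%g); first by rewrite big_ord0.
  by move=> s; apply/esym/eqP/permP; case.
rewrite enum_ordSl /= ediff_prod per_expand_row0 -map_comp.
have ediffs_sum l (I : finType) (F : I -> A) :
    ediffs l (\sum_i F i) = \sum_i ediffs l (F i).
  by elim: l F => //= e l IHl F; rewrite ediff_sum IHl.
have ediffsZ l a p : ediffs l (a *: p) = a *: ediffs l p.
  by elim: l p => //= e l IHl p; rewrite ediffZ IHl.
rewrite ediffs_sum raddf_sum /=; apply: eq_bigr => j _.
rewrite Mc mul_mpolyC ediffsZ mpolyCM -mul_mpolyC; congr (_ * _).
by apply: IHm => i k; rewrite /= Mc !mxE.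
Qed.

End Derivations.

(** * Eliminating the cycle *)

Section Cycle.
Variables (R : realType) (T : finType).
Local Notation A := {mpoly R[#|T|]}.
Local Notation X := (pvar R).
Local Notation D v := (mderiv (enum_rank v)).
Implicit Types (p q F : A) (x y : T) (a b : seq T).

(* The last vertex occurs twice: see the replaced column in the header. *)
Fixpoint path_form a : A :=
  match a with
  | [::] => 1
  | x :: s => if s is y :: _ then X x * (X x + X y) * path_form s
              else X x * X x
  end.

(* Applies [D x] for each vertex and [D x - D y] for each edge of the path,   *)
(* but [D x] to the power [k] at the last vertex; the two terms of the        *)
(* derivation of the closing edge correspond to [k = 2] and [k = 1].          *)
Fixpoint path_diff k a p : A :=
  match a with
  | [::] => p
  | x :: s => if s is y :: _ then path_diff k s (D x (D x p - D y p))
              else iter k (D x) p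
  end.

Lemma path_diff_cons k x y b p :
  path_diff k (x :: y :: b) p = path_diff k (y :: b) (D x (D x p - D y p)).
Proof. by []. Qed.

Lemma path_diffB k a p q : path_diff k a (p - q) = path_diff k a p - path_diff k a q.
Proof.
have iterB x i u v : iter i (D x) (u - v) = iter i (D x) u - iter i (D x) v :> A.
  by elim: i => //= i ->; rewrite mderivB.
elim: a p q => //= x [|y b] IHb p q; first exact: iterB.
by rewrite -IHb -mderivB !(mderivB (enum_rank x)) mderivB !opprD !addrA;
   congr (path_diff _ _ _); ring.
Qed.

Lemma path_diffMn k a p i : path_diff k a (p *+ i) = path_diff k a p *+ i.
Proof.
have iterMn x j u : iter j (D x) (u *+ i) = iter j (D x) u *+ i :> A.
  by elim: j => //= j ->; rewrite mderivMn.
elim: a p => //= x [|y b] IHb p; first exact: iterMn.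
by rewrite -IHb !mderivMn -mulrnBl mderivMn.
Qed.

(** No operator involved differentiates in [x], so the factor X_x survives. This discards the terms
    still containing X_x once [x] is eliminated. *)
Lemma path_diff_free k x a p : x \notin a -> (path_diff k a (X x * p))@_0 = 0.
Proof.
have X0 q : (X x * q)@_0 = 0.
  by rewrite (rmorphM (mcoeff 0)) /= /pvar mcoeffX -[0%MM]/(0)%MM mnm1_eq0 mul0r.
have DX y q : y != x -> D y (X x * q) = X x * D y q.
  by move=> /negPf yx; rewrite mderivM deriv_pvar yx mul0r add0r.
elim: a p => [|y b IHb] p; first by rewrite X0.
rewrite inE negb_or eq_sym => /andP[yx xb] /=.
case: b IHb xb => [|z b] IHb xb.
  suff ->: iter k (D y) (X x * p) = X x * iter k (D y) p by [].
  by elim: k {IHb} => //= k ->; rewrite DX.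
have zx : z != x by move: xb; rewrite inE negb_or eq_sym; case/andP.
by rewrite !DX // -mulrBr DX // IHb.
Qed.

Lemma deriv_path_form x a : x \notin a -> D x (path_form a) = 0.
Proof.
elim: a => [|y b IHb]; first by rewrite /= -mpolyC1 mderivC.
rewrite inE negb_or => /andP[xy xb] /=.
case: b IHb xb => [|z b] IHb xb; rewrite !mderivM ?mderivD !deriv_pvar.
  by rewrite (negPf xy) mul0r mulr0 addr0.
have xz : x != z by move: xb; rewrite inE negb_or; case/andP.
by rewrite (IHb xb) (negPf xy) (negPf xz) !(mul0r, mulr0, addr0).
Qed.

Section Step.
Variables (x y : T) (b : seq T).
Hypothesis xb : x \notin y :: b.
Let F := path_form (y :: b).
Let G := path_form (x :: y :: b).

Let derivE :
  (forall p, D x (X x * p) = p + X x * D x p)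
  * (forall p, D x (X y * p) = X y * D x p)
  * (forall p, D y (X x * p) = X x * D y p)
  * (D x F = 0) * (D x (D y F) = 0) * (D x (D y (X y * F)) = 0)
  * (G = X x * (X x * F) + X x * (X y * F)).
Proof.
have xy : x != y by move: xb; rewrite inE negb_or; case/andP.
have DF : D x F = 0 := deriv_path_form xb.
have DxX p : D x (X x * p) = p + X x * D x p.
  by rewrite mderivM deriv_pvar eqxx mul1r.
have DxY p : D x (X y * p) = X y * D x p.
  by rewrite mderivM deriv_pvar (negPf xy) mul0r add0r.
have DyX p : D y (X x * p) = X x * D y p.
  by rewrite mderivM deriv_pvar eq_sym (negPf xy) mul0r add0r.
have GE : G = X x * (X x * F) + X x * (X y * F).
  by rewrite -mulrDr -mulrDl mulrA.
by rewrite GE !(mderiv_comm (enum_rank y)) DxY DF mulr0 mderiv0.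
Qed.

(** As [F] is free of X_x, the operators of [x] turn [G] into 2 F - D_y (X_y F) - 2 X_x D_y F, whose
    last term contributes nothing. The middle term is not of the form [F], so its value must be
    carried along as a second unknown. *)
Lemma path_diff_form2 :
  (path_diff 2 (x :: y :: b) G)@_0 =
  (path_diff 2 (y :: b) F)@_0 *+ 2 - (path_diff 2 (y :: b) (D y (X y * F)))@_0.
Proof.
rewrite -[RHS]subr0 -(path_diff_free 2 (D y F *+ 2) xb) -mcoeffMn -path_diffMn.
rewrite -!mcoeffB -!path_diffB path_diff_cons; congr (mcoeff _ (path_diff _ _ _)).
by rewrite !(derivE, mderivB, mderivD, mulr0, addr0); ring.
Qed.

(** Closes the recurrence: if u and v are the values at F and D_y (X_y F), adding a vertex gives (2u
    - v, 6u - 2v). *)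
Lemma path_diff_mul2 :
  (path_diff 2 (x :: y :: b) (D x (X x * G)))@_0 =
  (path_diff 2 (y :: b) F)@_0 *+ 6
  - (path_diff 2 (y :: b) (D y (X y * F)))@_0 *+ 2.
Proof.
rewrite -[RHS]subr0 -(path_diff_free 2 (D y F *+ 6) xb) -!mcoeffMn -!path_diffMn.
rewrite -!mcoeffB -!path_diffB path_diff_cons; congr (mcoeff _ (path_diff _ _ _)).
by rewrite !(derivE, mderivB, mderivD, mulr0, addr0); ring.
Qed.

(** D_x D_x G = 2 F is already free of X_x, so only the -D_y half of the edge derivation acts and no
    term has to be discarded. *)
Lemma path_diff_deriv1 :
  path_diff 1 (x :: y :: b) (D x G) = - (path_diff 1 (y :: b) (D y F) *+ 2).
Proof.
rewrite -path_diffMn -[RHS]add0r -[in RHS](subrr (path_diff 1 (y :: b) 0)).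
rewrite -!path_diffB path_diff_cons; congr (path_diff _ _ _).
by rewrite !(derivE, mderivB, mderivD, mulr0, addr0); ring.
Qed.

End Step.

Lemma path_diff1E x b : uniq (x :: b) ->
  (path_diff 1 (x :: b) (D x (path_form (x :: b))))@_0 = (- 2) ^+ size b * 2.
Proof.
elim: b x => [|y b IHb] x /=.
  move=> _; rewrite mderivM deriv_pvar eqxx mul1r mulr1 mderivD.
  by rewrite deriv_pvar eqxx mcoeffD mcoeff1 eqxx mul1r.
case/andP=> xb ub; have /= -> := path_diff_deriv1 xb.
by rewrite mcoeffN mcoeffMn IHb //= exprS; ring.
Qed.

(** The map (u, v) -> (2u - v, 6u - 2v) squares to -2, so two more vertices double the absolute
    value while the bound quadruples. The values for one and two vertices are 2 and -2; the first
    attains the bound, hence [b != [::]]. *)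
Lemma path_diff2_lt x b : uniq (x :: b) -> b != [::] ->
  `|(path_diff 2 (x :: b) (path_form (x :: b)))@_0| < 2 ^+ (size b).+1.
Proof.
have base z : (path_diff 2 [:: z] (path_form [:: z]))@_0 = 2
  /\ (path_diff 2 [:: z] (D z (X z * path_form [:: z])))@_0 = 6.
  have DX p : D z (X z * p) = p + X z * D z p.
    by rewrite mderivM deriv_pvar eqxx mul1r.
  have D1 : D z (1 : A) = 0 by rewrite -mpolyC1 mderivC.
  rewrite /= !(DX, mderivD, deriv_pvar, eqxx, D1, mulr1, mulr0, addr0).
  by rewrite !mcoeffD !mcoeff1 eqxx; rewrite mulr1n; split; ring.
have [n] := ubnP (size b); elim: n x b => // n IHn x [|y [|z b]] //= lebn.
  case/andP=> xb _ _; have /= -> := path_diff_form2 xb.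
  have [/= -> ->] := base y.
  have -> : 2 *+ 2 - 6 = - 2 :> R by ring.
  by rewrite normrN ger0_norm; lra.
case/andP=> xb /andP[yb ub] _.
have /= -> := path_diff_form2 xb; have /= -> := path_diff_form2 yb.
have /= -> := path_diff_mul2 yb.
set u := (X in (X *+ 2 - _) *+ 2); set v := (X in u *+ 2 - X).
have ->: (u *+ 2 - v) *+ 2 - (u *+ 6 - v *+ 2) = - (u *+ 2) by ring.
rewrite normrN normrMn 2!exprS.
(* For three vertices the induction hypothesis would concern the single vertex [z], where the bound
   is not strict; its value 2 is used instead. *)
case: b ub @u {v} lebn yb xb => [|c b] ub u lebn yb xb.
  have [uE _] := base z; rewrite /u uE ger0_norm //; lra.
have := IHn z (c :: b) (ltnW lebn) ub isT; rewrite -/u exprS.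
have := normr_ge0 u; lra.
Qed.

Lemma path_diff_neq0 x b : uniq (x :: b) -> b != [::] ->
  (path_diff 2 (x :: b) (path_form (x :: b)))@_0
  - (path_diff 1 (x :: b) (D x (path_form (x :: b))))@_0 != 0.
Proof.
move=> ub b0; rewrite subr_eq0 path_diff1E //.
apply/eqP => /(congr1 Num.norm) E; have := path_diff2_lt ub b0.
by rewrite E normrM normrX normrN !ger0_norm // exprSr ltxx.
Qed.

End Cycle.

(** * Eliminating the tree *)

Lemma set2_eq (T : finType) (u v u' v' : T) : [set u; v] = [set u'; v'] ->
  u = u' /\ v = v' \/ u = v' /\ v = u'.
Proof.
move=> E.
have /set2P uE : u \in [set u'; v'] by rewrite -E set21.
have /set2P vE : v \in [set u'; v'] by rewrite -E set22.
have /set2P u'E : u' \in [set u; v] by rewrite E set21.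
have /set2P v'E : v' \in [set u; v] by rewrite E set22.
by intuition congruence.
Qed.

Section Ediffs.
Variables (R : realType) (T : finType).
Local Notation A := {mpoly R[#|T|]}.
Local Notation X := (pvar R).
Local Notation D v := (mderiv (enum_rank v)).
Implicit Types (p q F : A) (x y v : T) (a b : seq T) (e : T * T) (l : seq (T * T)).

Definition derivs a p : A := foldr (fun v q => D v q) p a.

Lemma derivs_perm a b p : perm_eq a b -> derivs a p = derivs b p.
Proof.
move=> ab; rewrite /derivs -!(foldr_map enum_rank (fun i => mderiv i)).
exact/mderiv_perm/perm_map.
Qed.

Lemma derivs_comm v a p : D v (derivs a p) = derivs a (D v p).
Proof. by elim: a => //= u a IHa; rewrite mderiv_comm IHa. Qed.

Lemma ediff_comm e v p : D v (ediff e p) = ediff e (D v p).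
Proof. by rewrite /ediff mderivB !(mderiv_comm (enum_rank v)). Qed.

Lemma ediffs_comm l v p : D v (ediffs l p) = ediffs l (D v p).
Proof. by elim: l p => //= e l IHl p; rewrite IHl ediff_comm. Qed.

Lemma ediffsB l p q : ediffs l (p - q) = ediffs l p - ediffs l q.
Proof.
elim: l p q => //= e l IHl p q; rewrite -IHl /ediff !mderivB.
by rewrite !opprD !addrA; congr (ediffs _ _); ring.
Qed.

Lemma ediff_ediffs e l p : ediff e (ediffs l p) = ediffs l (ediff e p).
Proof. by rewrite /ediff !ediffs_comm ediffsB. Qed.

Lemma ediff_derivs e a p : ediff e (derivs a p) = derivs a (ediff e p).
Proof. by elim: a => //= v a IHa; rewrite -ediff_comm IHa. Qed.

Lemma ediffs_cat l l' p : ediffs (l ++ l') p = ediffs l' (ediffs l p).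
Proof. exact: foldl_cat. Qed.

Lemma ediffsN l p : ediffs l (- p) = - ediffs l p.
Proof.
have ediffs0 : ediffs l (0 : A) = 0.
  by elim: l => //= e l IHl; rewrite /ediff !mderiv0 subrr.
by rewrite -sub0r ediffsB ediffs0 sub0r.
Qed.

(** Edge derivations commute, and reversing a pair negates its derivation. Hence the elimination may
    use its own order and directions, independent of the rows of the matrix. *)
Lemma ediffs_sign l l' p :
    perm_eq [seq [set e.1; e.2] | e <- l] [seq [set e.1; e.2] | e <- l'] ->
  ediffs l p = ediffs l' p \/ ediffs l p = - ediffs l' p.
Proof.
elim: l l' p => [|e l IHl] l' p /=.
  by move/perm_size; rewrite /= size_map; case: l' => //; left.
move=> ll'.
have /mapP[e' e'l' ee'] : [set e.1; e.2] \in [seq [set e.1; e.2] | e <- l'].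
  by rewrite -(perm_mem ll') mem_head.
case/splitPr: e'l' ll' => l1 l2; rewrite map_cat /= -ee' perm_sym.
rewrite perm_catC /= perm_cons perm_catC -map_cat perm_sym => /IHl {}IHl.
have -> : ediffs (l1 ++ e' :: l2) p = ediffs (l1 ++ l2) (ediff e' p).
  by rewrite !ediffs_cat /= ediff_ediffs.
have [->|->] : ediff e p = ediff e' p \/ ediff e p = - ediff e' p.
- rewrite /ediff; case: (set2_eq ee') => -[-> ->]; first by left.
  by right; rewrite opprB.
- exact: IHl.
- by rewrite ediffsN; case: (IHl (ediff e' p)) => ->; [right | left; rewrite opprK].
Qed.

Fixpoint path_pairs a : seq (T * T) :=
  if a is x :: s then if s is y :: _ then (x, y) :: path_pairs s else [::]
  else [::].

Definition cycle_pairs x b := path_pairs (x :: b) ++ [:: (last x b, x)].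

Lemma path_diff_comm k a v p : D v (path_diff k a p) = path_diff k a (D v p).
Proof.
elim: a p => //= x [|y b] IHb p.
  by elim: (k) => //= j IHj; rewrite mderiv_comm IHj.
by rewrite IHb !(mderiv_comm (enum_rank v), mderivB).
Qed.

Lemma path_diff_last x b p :
  path_diff 2 (x :: b) p = path_diff 1 (x :: b) (D (last x b) p).
Proof.
elim: b x p => //= y b IHb x p; rewrite IHb; congr (path_diff 1 (y :: b) _).
by rewrite !(mderiv_comm (enum_rank (last y b)), mderivB).
Qed.

Lemma path_diff1_ediffs x b p :
  path_diff 1 (x :: b) p = ediffs (path_pairs (x :: b)) (derivs (x :: b) p).
Proof.
elim: b x p => // y b IHb x p; rewrite path_diff_cons IHb.
have -> : ediffs (path_pairs [:: x, y & b]) (derivs [:: x, y & b] p) =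
    ediffs (path_pairs (y :: b)) (ediff (x, y) (D x (derivs (y :: b) p))) by [].
rewrite derivs_comm ediff_derivs; congr (ediffs _ (derivs _ _)).
by rewrite mderivB (mderiv_comm (enum_rank y)).
Qed.

(** The derivation of the closing edge has two halves: the one at the last vertex raises the power
    there to 2, the one at [x] leaves it at 1. *)
Lemma ediffs_cycle x b p :
  ediffs (cycle_pairs x b) (derivs (x :: b) p) =
  path_diff 2 (x :: b) p - path_diff 1 (x :: b) (D x p).
Proof.
rewrite ediffs_cat -path_diff1_ediffs path_diff_last.
rewrite -[LHS]/(D (last x b) (path_diff 1 (x :: b) p)
  - D x (path_diff 1 (x :: b) p)).
by rewrite !path_diff_comm.
Qed.

(** An order of building a tree outwards from [U]: each pair is a new vertex followed by its
    parent. *)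
Fixpoint grows (U : {set T}) l : bool :=
  if l is e :: l' then [&& e.2 \in U, e.1 \notin U & grows (e.1 |: U) l']
  else true.

Lemma grows_fst U l : grows U l ->
  uniq [seq e.1 | e <- l] && all [predC U] [seq e.1 | e <- l].
Proof.
elim: l U => //= e l IHl U /and3P[_ -> /IHl/andP[-> lU]].
rewrite !andbT /=; apply/andP; split.
  by apply/negP => /(allP lU); rewrite /= !inE eqxx.
by apply/allP => v /(allP lU); rewrite /= !inE negb_or => /andP[].
Qed.

Lemma deriv_prod_pvar v l a : v \notin [seq e.1 | e <- l] ->
  D v (\prod_(e <- l | e.1 \notin a) X e.1) = 0.
Proof.
elim: l => [|e l IHl] /=; first by rewrite big_nil -mpolyC1 mderivC.
rewrite inE negb_or big_cons => /andP[/negPf ve /IHl{}IHl].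
by case: ifP => // _; rewrite mderivM IHl deriv_pvar ve mulr0 mul0r addr0.
Qed.

(* In the tree, the parent end of each edge contributes nothing: its variable *)
(* was removed when the parent was reached.                                   *)
Lemma ediffs_tree a U l p :
    grows U l -> (forall e, e \in l -> e.2 \notin a) ->
    (forall v, v \notin a -> D v p = 0) ->
  ediffs l ((\prod_(e <- l | e.1 \notin a) X e.1) * p) =
  derivs [seq v <- [seq e.1 | e <- l] | v \in a] p.
Proof.
elim: l U p => [|e l IHl] U p /=; first by rewrite big_nil mul1r.
case/and3P=> e2U e1U gl la pa.
have /andP[_ lU] := grows_fst gl.
have e1l : e.1 \notin [seq e.1 | e <- l].
  by apply/negP => /(allP lU); rewrite /= !inE eqxx.
have e2l : e.2 \notin [seq e.1 | e <- l].
  by apply/negP => /(allP lU); rewrite /= !inE e2U orbT.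
have e2a := la e (mem_head _ _).
have {}la e' : e' \in l -> e'.2 \notin a by move=> el; apply: la; rewrite inE el orbT.
have e12 : e.2 != e.1 by apply: contraNneq e1U => <-.
rewrite /ediff big_cons; case: ifPn => e1a.
  rewrite -mulrA !mderivM !deriv_prod_pvar // !pa // !deriv_pvar eqxx (negPf e12).
  rewrite !(mul0r, mulr0, addr0, mul1r, subr0) (negPf e1a).
  exact: IHl gl la pa.
rewrite !mderivM !deriv_prod_pvar // (pa _ e2a) (negPn e1a) !(mul0r, mulr0, add0r, subr0).
rewrite (IHl _ _ gl la) -?derivs_comm // => v /pa; rewrite mderiv_comm => ->.
by rewrite mderiv0.
Qed.

Lemma ediffs_halin_neq0 w x b l :
    uniq (x :: b) -> b != [::] -> grows [set w] l ->
    (forall e, e \in l -> e.2 \notin x :: b) ->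
    {subset x :: b <= [seq e.1 | e <- l]} ->
  (ediffs (l ++ cycle_pairs x b)
     ((\prod_(e <- l | e.1 \notin x :: b) X e.1) * path_form R (x :: b)))@_0 != 0.
Proof.
move=> ub b0 gl la ab; rewrite ediffs_cat (ediffs_tree gl la); last first.
  by move=> v; exact: deriv_path_form.
rewrite (derivs_perm (b := x :: b)).
  by rewrite ediffs_cycle mcoeffB path_diff_neq0.
apply: uniq_perm => //; first by rewrite filter_uniq //; case/andP: (grows_fst gl).
by move=> v; rewrite mem_filter; case: (boolP (v \in x :: b)) => // /ab ->.
Qed.

Lemma path_formE x b :
  path_form R (x :: b) = (\prod_(v <- x :: b) X v)
    * (\prod_(e <- path_pairs (x :: b)) (X e.1 + X e.2)) * X (last x b).
Proof.
elim: b x => [|y b IHb] x; first by rewrite /= big_seq1 big_nil mulr1.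
rewrite [path_pairs _]/= [path_form _ _]/= -/(path_form R (y :: b)) IHb.
rewrite [in RHS]big_cons (big_cons _ _ (x, y)) /=; ring.
Qed.

End Ediffs.

(** * The permanent and choices from two-element lists *)

(** Expand the product over the rows: [phi i] is the column picked in row [i], or [None] for the
    constant. The sum over [t] splits into a factor per column, and a column never picked gives 1 -
    1 = 0. With as many rows as columns, only permutations survive. *)
Lemma alternating_sum_per (R : realType) m (M : 'M[R]_m) (c : 'I_m -> R)
    (x : bool -> 'I_m -> R) :
  \sum_(t : {ffun 'I_m -> bool}) (\prod_j (-1) ^+ t j) *
    \prod_i (c i + \sum_j M i j * x (t j) j) =
  per M * \prod_j (x false j - x true j).
Proof.
pose coef i o := if o is Some j then M i j else c i.
pose var t o : R := if o is Some j then x (t j : bool) j else 1.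
pose F (phi : {ffun 'I_m -> option 'I_m}) := (\prod_i coef i (phi i)) *
  \prod_j (x false j ^+ #|[set i | phi i == Some j]|
           - x true j ^+ #|[set i | phi i == Some j]|).
transitivity (\sum_phi F phi).
  under eq_bigr => t _.
    have E i : c i + \sum_j M i j * x (t j) j = \sum_o coef i o * var t o.
      rewrite (bigD1 None) //= mulr1; congr (_ + _).
      rewrite (reindex_omap Some id) /=; last by case.
      by apply: eq_bigl => j; rewrite eqxx.
    under [X in _ * X]eq_bigr => i _ do rewrite E.
    rewrite bigA_distr_bigA big_distrr /=.
    over.
  rewrite exchange_big /=; apply: eq_bigr => phi _.
  have varE t : \prod_i var t (phi i) =
      \prod_j x (t j) j ^+ #|[set i | phi i == Some j]|.
    rewrite (partition_big phi predT) //= (bigD1 None) //= big1 ?mul1r.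
      rewrite (reindex_omap Some id) /=; last by case.
      apply: eq_big => [j|j _]; first by rewrite eqxx.
      rewrite -prodr_const; apply: eq_big => [i|i /eqP ->] //.
      by rewrite inE.
    by move=> i /eqP ->.
  under eq_bigr => t _ do rewrite big_split /= mulrCA varE -big_split /=.
  rewrite -big_distrr /=; congr (_ * _).
  under [RHS]eq_bigr => j _ do
    rewrite -[X in X - _]mul1r -mulN1r -[1]/((-1) ^+ false : R)
      -[X in _ + X * _]/((-1) ^+ true : R).
  have boolE j : (-1) ^+ false * x false j ^+ #|[set i | phi i == Some j]|
      + (-1) ^+ true * x true j ^+ #|[set i | phi i == Some j]| =
      \sum_(b : bool) (-1) ^+ b * x b j ^+ #|[set i | phi i == Some j]|.
    by rewrite big_bool /= addrC.
  by under [RHS]eq_bigr => j _ do rewrite boolE; rewrite bigA_distr_bigA.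
pose Phi (s : 'S_m) := [ffun i => Some (s i)].
have Phi_inj : injective Phi.
  by move=> s s' /ffunP E; apply/permP => i; have := E i; rewrite !ffunE => -[].
rewrite (bigID (mem (Phi @: setT))) /= [X in _ + X]big1 ?addr0; last first.
  move=> phi phiN; have [[j] j0|] := pselect (exists j, [set i | phi i == Some j] = set0).
    rewrite /F [X in _ * X](bigD1 j) //= j0 cards0 !expr0 subrr mul0r mulr0 //.
  move=> hit; case/negP: phiN.
  (* A [phi] that hits every column has a section; being injective, the section is a permutation,
     and [phi] is its inverse. *)
  have /fin_all_exists[f phif] j : exists i, phi i = Some j.
    have /set0Pn[i] : [set i | phi i == Some j] != set0.
      by apply/eqP => j0; apply: hit; exists j.
    by rewrite inE => /eqP; exists i.
  have f_inj : injective f by apply: (can_inj (g := fun i => odflt i (phi i))) => j; rewrite phif.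
  apply/imsetP; exists (perm f_inj)^-1%g => //; apply/ffunP => i; rewrite ffunE.
  by rewrite -[in LHS](permKV (perm f_inj) i) permE phif.
rewrite big_imset /=; last by move=> s s' _ _; exact: Phi_inj.
rewrite /per big_distrl /=; apply: eq_big => [s|s _]; first by rewrite inE.
rewrite /F; congr (_ * _).
  by apply: eq_bigr => i _; rewrite ffunE.
apply: eq_bigr => j _; suff -> : #|[set i | Phi s i == Some j]| = 1%N by [].
rewrite -(cards1 (s^-1 j)%g); congr #|pred_of_set _|; apply/setP => i.
by rewrite !inE ffunE -(inj_eq (@perm_inj _ s) i) permKV.
Qed.

(** Otherwise the product over the rows vanishes at every corner of the box, and so does the
    alternating sum. *)
Lemma per_neq0_choice (R : realType) m (M : 'M[R]_m) (c a b : 'I_m -> R) :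
    per M != 0 -> (forall j, a j != b j) ->
  exists t : 'I_m -> bool,
    forall i, c i + \sum_j M i j * (if t j then b j else a j) != 0.
Proof.
move=> M0 ab.
have : per M * \prod_j (a j - b j) != 0.
  by rewrite mulf_neq0 //; apply/prodf_neq0 => j _; rewrite subr_eq0.
rewrite -(alternating_sum_per M c (fun t j => if t then b j else a j)).
move=> sum0; apply: contrapT => H; case/negP: sum0; apply/eqP.
apply: big1 => t _; rewrite [X in _ * X](_ : _ = 0) ?mulr0 //.
apply/eqP/negPn/negP => /prodf_neq0 t0; apply: H; exists t => i.
exact: t0.
Qed.

(** * Columns of the matrix of a graph *)

Section Columns.
Variables (R : realType) (T : finType) (G : sgraph T).
Local Notation A := {mpoly R[#|T|]}.
Local Notation X := (pvar R).
Local Notation D v := (mderiv (enum_rank v)).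
Implicit Types (z : T + edge G) (o : orientation G) (e : edge G).

Definition incidence (v : T) z : R :=
  match z with
  | inl u => (v == u)%:R
  | inr f => (v \in val f)%:R
  end.

Definition col_form z : A :=
  match z with
  | inl u => X u
  | inr f => \sum_(v in val f) X v
  end.

Lemma deriv_col_form v z : D v (col_form z) = (incidence v z)%:MP.
Proof.
case: z => [u|f] /=; first by rewrite deriv_pvar rmorph_nat.
rewrite raddf_sum /= rmorph_nat; under eq_bigr do rewrite deriv_pvar.
have [vf|vf] := boolP (v \in val f).
  rewrite (bigD1 v) //= eqxx big1 ?addr0 // => u /andP[_ /negPf].
  by rewrite eq_sym => ->.
by rewrite big1 // => u uf; case: eqP => // vu; rewrite vu uf in vf.
Qed.

Lemma orientation_neq o e : arc_tail o e != arc_head o e.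
Proof.
have := valP e; rewrite (orientationP o) => /imsetP[[u v]]; rewrite inE /= => uv E.
apply/eqP => ht; move: uv; have [[<- <-]|[<- <-]] := set2_eq E;
  by rewrite ht adj_irr.
Qed.

(** At the column of [e] itself the two incidences cancel, which matches its exclusion in [meets].
    Another edge cannot contain both ends of [e], so the order of the tests in [A_entry] is
    harmless. *)
Lemma A_entryE o e z :
  A_entry R o e z = incidence (arc_head o e) z - incidence (arc_tail o e) z.
Proof.
have ht := orientation_neq o e; have eE := orientationP o e.
rewrite /A_entry /meets; case: z => [u|f] /=.
  rewrite !(eq_sym u); case: eqP => [<-|_].
    by rewrite (negPf ht) subr0.
  by case: eqP; rewrite ?subr0 ?sub0r.
have [->|fe] := eqVneq f e; first by rewrite eE set21 set22 subrr.
rewrite /=; case: ifP => hf; last by case: ifP; rewrite ?subr0 ?sub0r.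
suff -> : (arc_tail o e \in sval f) = false by rewrite subr0.
apply: contra_neqF fe => tf; apply/val_inj; rewrite eE.
have /imsetP[[u v] _ /= fE] := valP f.
move: hf tf; rewrite fE !inE.
case/orP=> /eqP hE /orP [] /eqP tE; rewrite hE tE //.
- by rewrite hE tE eqxx in ht.
- by rewrite setUC.
- by rewrite hE tE eqxx in ht.
Qed.

Lemma sum_incidence (f : T + edge G -> R) v :
  \sum_z incidence v z * f z = vertex_sum f v.
Proof.
rewrite big_sumType /=; congr (_ + _).
  rewrite (bigD1 v) //= eqxx mul1r big1 ?addr0 // => u.
  by rewrite eq_sym => /negPf ->; rewrite mul0r.
rewrite [RHS]big_mkcond; apply: eq_bigr => e _.
by case: (_ \in _); rewrite ?mul1r ?mul0r.
Qed.

(** The derivations of the rows give the permanent as a constant polynomial, and [l] gives the same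
    up to sign; [z0] serves as the default of [nth]. *)
Lemma per_columns o (l : seq (T * T)) (z0 : T + edge G) (zs : seq (T + edge G)) :
    perm_eq [seq [set p.1; p.2] | p <- l] [seq val e | e <- enum {: edge G}] ->
    uniq zs -> size zs = #|{: edge G}| ->
    (ediffs l (\prod_(z <- zs) col_form z))@_0 != 0 ->
  exists2 s : {ffun 'I_#|{: edge G}| -> 'I_#|{: T + edge G}|},
    injective s & per (colsub s (A_mx R o)) != 0.
Proof.
move=> lE uzs szs nz.
pose s := [ffun i : 'I_#|{: edge G}| => enum_rank (nth z0 zs i)].
exists s.
  move=> i j; rewrite !ffunE => /enum_rank_inj/eqP.
  by rewrite nth_uniq ?szs // => /eqP/val_inj.
pose es (i : 'I_#|{: edge G}|) := (arc_head o (enum_val i), arc_tail o (enum_val i)).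
have esE : [seq [set p.1; p.2] | p <- [seq es i | i <- enum 'I_#|{: edge G}|]] =
    [seq val e | e <- [seq enum_val i | i <- enum 'I_#|{: edge G}|]].
  by rewrite -!map_comp; apply: eq_map => i; rewrite /= (orientationP o) setUC.
have enumE : perm_eq [seq enum_val i | i <- enum 'I_#|{: edge G}|] (enum {: edge G}).
  apply: uniq_perm; rewrite ?enum_uniq ?(map_inj_uniq enum_val_inj) ?enum_uniq //.
  move=> e; rewrite mem_enum; apply/mapP; exists (enum_rank e); first by rewrite mem_enum.
  by rewrite enum_rankK.
have perE : ediffs [seq es i | i <- enum 'I_#|{: edge G}|]
    (\prod_(z <- zs) col_form z) = (per (colsub s (A_mx R o)))%:MP.
  rewrite (big_nth z0) szs big_mkord; apply: per_ediff => i j.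
  rewrite !mxE ffunE enum_rankK A_entryE rmorphB /=.
  by rewrite /ediff !deriv_col_form.
apply: contraNneq nz => per0; move: perE; rewrite per0 rmorph0.
have : perm_eq [seq [set p.1; p.2] | p <- l]
    [seq [set p.1; p.2] | p <- [seq es i | i <- enum 'I_#|{: edge G}|]].
  by rewrite esE; apply: perm_trans lE _; rewrite perm_sym perm_map.
move/(ediffs_sign (\prod_(z <- zs) col_form z)) => [->|->] ->; first by rewrite mcoeff0.
by rewrite oppr0 mcoeff0.
Qed.

(** Injectivity means that no column is repeated; the value 0 is excluded because the row of [e0]
    must be assigned some column. *)
Lemma pind_eq1 o (s : {ffun 'I_#|{: edge G}| -> 'I_#|{: T + edge G}|}) (e0 : edge G) :
  injective s -> per (colsub s (A_mx R o)) != 0 -> pind (A_mx R o) = Some 1%N.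
Proof.
move=> s_inj s_per.
have le1 : pind_le (A_mx R o) 1.
  apply/existsP; exists s; rewrite s_per /=; apply/forallP => j.
  by apply/card_le1_eqP => i i'; rewrite !inE => /eqP <- /eqP /s_inj.
rewrite /pind; case: pselect => [exk|[]]; last by exists 1%N.
congr Some; case: ex_minnP => k kP /(_ _ le1); case: k kP => [|[]] //.
case/existsP => s' /andP[_ /forallP/(_ (s' (enum_rank e0)))].
by rewrite leqn0 cards_eq0 => /eqP/setP/(_ (enum_rank e0)); rewrite !inE eqxx.
Qed.

Lemma vertex_sum_neq (f : T + edge G -> R) o :
    (forall e, \sum_z A_entry R o e z * f z != 0) -> proper_weighting f.
Proof.
move=> f0 u v uv.
have uvG : [set u; v] \in edges G by apply/imsetP; exists (u, v); rewrite ?inE.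
pose e : edge G := exist _ [set u; v] uvG; have := f0 e.
under eq_bigr => z _ do rewrite A_entryE mulrBl.
rewrite sumrB !sum_incidence subr_eq0 => /eqP.
by have [[-> ->]|[-> ->]] := set2_eq (orientationP o e);
  [move=> ne E; apply: ne | ].
Qed.

(** Columns outside the image of [s] are fixed at the first value of their list and enter as the
    constants [c]; each chosen column switches between its two values. *)
Lemma choosable22 o (s : {ffun 'I_#|{: edge G}| -> 'I_#|{: T + edge G}|}) :
  injective s -> per (colsub s (A_mx R o)) != 0 -> choosable R G 2 2.
Proof.
move=> s_inj s_per L LV LE.
have L2 z : exists ab : R * R, [/\ ab.1 \in L z, ab.2 \in L z & ab.1 != ab.2].
  have : #|` L z| = 2%N by case: z => ?.
  case: (L z) => -[|a [|b []]] //= i _; exists (a, b).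
  have : uniq [:: a; b] by apply: (canonical_uniq i).
  by rewrite /= inE andbT => ab; split => //; rewrite !inE eqxx ?orbT.
have [ab abP] := choice L2.
pose av (k : 'I_#|{: T + edge G}|) := (ab (enum_val k)).1.
pose bv (k : 'I_#|{: T + edge G}|) := (ab (enum_val k)).2.
pose c i := \sum_(k | k \notin codom s) A_mx R o i k * av k.
have [|t tP] := per_neq0_choice (a := av \o s) (b := bv \o s) c s_per.
  by move=> j; case: (abP (enum_val (s j))).
pose tau k := [exists j, (s j == k) && t j].
pose g k := if tau k then bv k else av k.
exists (fun z => g (enum_rank z)); last first.
  move=> z; rewrite /g /av /bv enum_rankK; have [? ? _] := abP z.
  by case: ifP.
apply: (@vertex_sum_neq _ o) => e.
have := tP (enum_rank e).
rewrite [X in X != 0 -> _](_ : _ = \sum_z A_entry R o e z * g (enum_rank z)) //.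
rewrite [RHS](reindex (@enum_val _ {: T + edge G})) /=; last first.
  by apply: onW_bij; exists enum_rank; [exact: enum_valK | exact: enum_rankK].
rewrite addrC [RHS](bigID (mem (codom s))) /=; congr (_ + _); last first.
  apply: eq_bigr => k kN; rewrite mxE enum_rankK enum_valK /g; case: ifP => //.
  by case/existsP => j /andP[/eqP kE _]; rewrite -kE codom_f in kN.
rewrite (eq_bigl (mem (s @: setT))) => [|k]; last first.
  by apply/codomP/imsetP => [[j ->]|[j _ ->]]; exists j.
rewrite big_imset /=; last by move=> j j' _ _; exact: s_inj.
apply: eq_big => [j|j _]; first by rewrite inE.
have tauE : tau (s j) = t j.
  apply/existsP/idP => [[i /andP[/eqP/s_inj -> //]]|tj].
  by exists j; rewrite eqxx.
by rewrite !mxE enum_rankK enum_valK /g tauE.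
Qed.

End Columns.

(** * Trees and the leaf cycle *)

Section Trees.
Variables (T : finType) (t : sgraph T).
Implicit Types (U : {set T}) (l : seq (T * T)).

Lemma leaf_nbr x y z : leaf t x -> t x y -> t x z -> y = z.
Proof.
move=> /cards1P[u uE] xy xz.
have : y \in nbr t x by rewrite inE.
have : z \in nbr t x by rewrite inE.
by rewrite uE !inE => /eqP -> /eqP ->.
Qed.

(** Two different neighbours of [c] would be joined by a simple path inside [U], which [c] closes to
    a cycle. *)
Lemma acyclic_unique_nbr U c u v : is_tree t ->
    (forall a b, a \in U -> b \in U ->
      connect [rel a b | [&& a \in U, b \in U & t a b]] a b) ->
    c \notin U -> u \in U -> v \in U -> t c u -> t c v -> u = v.
Proof.
case=> _ acyc Uconn cU uU vU cu cv; apply/eqP/negPn/negP => uv; apply: acyc.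
have /connectP[p0 p0path p0last] := Uconn u v uU vU.
move: uv cv vU; rewrite {v}p0last => uv cv vU.
case/shortenP: p0path uv cv vU => p ppath up _ {p0} uv cv vU.
have pU : all (mem U) (u :: p).
  rewrite /= uU /=; move: ppath; clear -uU; elim: p u uU => //= w p IHp u uU.
  by case/andP=> /and3P[_ wU _] /(IHp w wU) ->; rewrite wU.
exists [:: c, u & p].
  by case: p uv {ppath up cv vU pU} => //=; rewrite eqxx.
rewrite /ucycle [uniq _]/= -/(uniq (u :: p)) up andbT; apply/andP; split; last first.
  by apply/negP => /(allP pU); rewrite /= (negPf cU).
rewrite /= cu rcons_path adj_sym cv andbT /=.
by apply: sub_path ppath => a b /= /and3P[].
Qed.

(** Connectedness supplies an edge leaving [U], and acyclicity makes it the only edge from the new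
    vertex to [U], so no edge is missed. A parent other than [w] has a neighbour in [U] besides its
    new child, so it is not a leaf. *)
Lemma tree_grows_from w U : is_tree t -> w \in U ->
    (forall u, u \in U -> u != w -> exists2 p, p \in U & t u p) ->
    (forall a b, a \in U -> b \in U ->
      connect [rel a b | [&& a \in U, b \in U & t a b]] a b) ->
  exists l, [/\ grows U l,
    forall e, e \in l -> t e.1 e.2,
    forall v, (v \in U) || (v \in [seq e.1 | e <- l]),
    forall u v, t u v -> [|| (u \in U) && (v \in U), (u, v) \in l | (v, u) \in l] &
    forall e, e \in l -> (e.2 == w) || ~~ leaf t e.2].
Proof.
move=> tree; have [n] := ubnP #|~: U|; elim: n U => // n IHn U leUn wU Upar Uconn.
have [UT|] := eqVneq U setT.
  by exists [::]; split=> // [v|u v _]; rewrite UT !inE.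
rewrite -subTset => /subsetPn[z _ zU].
have [u [c [uU cU uc]]] : exists u c, [/\ u \in U, c \notin U & t u c].
  apply: contrapT => H; case: tree => conn _.
  have cl : closed t (mem U).
    apply: intro_closed => [|u v uv uU]; first by apply: sym_connect_sym; exact: adj_sym.
    by apply: contrapT => /negP vU; apply: H; exists u, v.
  by have := closed_connect cl (conn w z); rewrite /= wU (negPf zU).
have cu : t c u by rewrite adj_sym.
have cuniq v : v \in U -> t c v -> v = u.
  by move=> vU cv; apply: (acyclic_unique_nbr tree Uconn cU).
have uc_neq : u != c by apply: contraNneq cU => <-.
have leU : (#|~: (c |: U)| < n)%N.
  rewrite -ltnS; apply: leq_trans leUn; rewrite ltnS.
  apply: proper_card; rewrite properC properE subsetUr /=.
  by apply/subsetPn; exists c; rewrite ?setU11.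
case: (IHn _ leU) => [||a b|l [gl lt lV lE lleaf]].
- by rewrite inE wU orbT.
- move=> v; rewrite !inE => /orP[/eqP->|vU vw].
    by move=> _; exists u; rewrite // !inE uU orbT.
  by have [p pU vp] := Upar v vU vw; exists p; rewrite // !inE pU orbT.
- have sub x y : connect [rel a b | [&& a \in U, b \in U & t a b]] x y ->
      connect [rel a b | [&& a \in c |: U, b \in c |: U & t a b]] x y.
    apply: connect_sub => {}x {}y /= /and3P[xU yU xy]; apply: connect1.
    by rewrite /= !inE xU yU xy !orbT.
  have cu1 : connect [rel a b | [&& a \in c |: U, b \in c |: U & t a b]] c u.
    by apply: connect1; rewrite /= !inE eqxx uU orbT.
  have uc1 : connect [rel a b | [&& a \in c |: U, b \in c |: U & t a b]] u c.
    by apply: connect1; rewrite /= !inE eqxx uU orbT.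
  rewrite !inE => /orP[/eqP->|aU] /orP[/eqP->|bU]; first exact: connect0.
  + exact/(connect_trans cu1)/sub/Uconn.
  + by apply: connect_trans uc1; exact/sub/Uconn.
  + exact/sub/Uconn.
exists ((c, u) :: l); split=> /=.
- by rewrite uU cU gl.
- by move=> e; rewrite inE => /orP[/eqP->|/lt].
- by move=> v; have := lV v; rewrite !inE orbCA orbA.
- move=> a b ab; have := lE a b ab; rewrite !inE -!pair_eqE /= /pair_eq /=.
  case/orP; last by case/orP => ->; rewrite !orbT.
  case/andP=> /orP[/eqP ac|aU] /orP[/eqP bc|bU].
  + by move: ab; rewrite ac bc adj_irr.
  + by rewrite ac eqxx (cuniq b) ?eqxx ?orbT // -ac.
  + by rewrite bc eqxx (cuniq a) ?eqxx ?orbT // -bc adj_sym.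
  + by rewrite aU bU.
- move=> e; rewrite inE => /orP[/eqP-> /=|/lleaf //].
  have [//|uw] := eqVneq u w; have [p pU up] := Upar u uU uw.
  apply/negP => lu; have := leaf_nbr lu up uc => pc.
  by rewrite -pc pU in cU.
Qed.

Lemma tree_grows w : is_tree t ->
  exists l, [/\ grows [set w] l,
    forall e, e \in l -> t e.1 e.2,
    forall v, v != w -> v \in [seq e.1 | e <- l],
    forall u v, t u v -> ((u, v) \in l) || ((v, u) \in l) &
    forall e, e \in l -> (e.2 == w) || ~~ leaf t e.2].
Proof.
move=> tree; case: (@tree_grows_from w [set w] tree); rewrite ?set11 //.
- by move=> u /set1P ->; rewrite eqxx.
- by move=> a b /set1P -> /set1P ->; exact: connect0.
move=> l [gl lt lV lE ll]; exists l; split => // [v|u v uv].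
  by have := lV v; rewrite inE; case: eqP.
have := lE u v uv; rewrite !inE => /orP[/andP[/eqP uw /eqP vw]|//].
by move: uv; rewrite uw vw adj_irr.
Qed.

(** The two leaves form a set closed under adjacency, which by connectedness is the whole tree. *)
Lemma adjacent_leaves x y z : is_tree t ->
  leaf t x -> leaf t y -> t x y -> (z == x) || (z == y).
Proof.
case=> conn _ lx ly xy.
have cl : closed t (mem [set x; y]).
  apply: intro_closed => [|u v uv]; first by apply: sym_connect_sym; exact: adj_sym.
  rewrite !inE => /orP[/eqP uE|/eqP uE]; rewrite uE in uv.
    by rewrite (leaf_nbr lx uv xy) eqxx orbT.
  by rewrite (leaf_nbr ly uv (y := v) (z := x)) ?eqxx // adj_sym.
by have := closed_connect cl (conn x z); rewrite !inE eqxx => <-.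
Qed.

Lemma grows_edges_uniq U l : grows U l ->
  uniq [seq [set e.1; e.2] | e <- l].
Proof.
elim: l U => //= e l IHl U /and3P[e2U e1U gl].
rewrite (IHl _ gl) andbT; apply/mapP => -[e' e'l eE].
have /andP[_ /allP/(_ e'.1)] := grows_fst gl.
rewrite map_f // => /(_ isT) /=.
have : e'.1 \in [set e.1; e.2] by rewrite eE set21.
by rewrite !inE => /orP[/eqP->|/eqP->]; rewrite ?eqxx // e2U orbT.
Qed.

End Trees.

Section Cycles.
Variable T : finType.
Implicit Types (x y : T) (a b : seq T).

Lemma path_pairs_cons x y b : path_pairs [:: x, y & b] = (x, y) :: path_pairs (y :: b).
Proof. by []. Qed.

Lemma path_pairs_mem a e : e \in path_pairs a -> (e.1 \in a) && (e.2 \in a).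
Proof.
elim: a => //= x [|y b] IHb //; rewrite inE => /orP[/eqP->|/IHb/andP[e1 e2]].
  by rewrite /= !inE !eqxx orbT.
by rewrite inE e1 orbT inE e2 orbT.
Qed.

Lemma path_pairs_uniq a : uniq a -> uniq [seq [set e.1; e.2] | e <- path_pairs a].
Proof.
elim: a => // x [|y b] IHb // /andP[xb ub]; rewrite path_pairs_cons map_cons cons_uniq.
rewrite (IHb ub) andbT.
apply/mapP => -[e /path_pairs_mem/andP[e1 e2] eE].
have : x \in [set e.1; e.2] by rewrite -eE set21.
by rewrite !inE => /orP[/eqP xE|/eqP xE]; move: xb; rewrite xE ?e1 ?e2.
Qed.

(** On two vertices the closing edge would repeat the path edge, hence the bound on [size b]. *)
Lemma cycle_pairs_uniq x b : uniq (x :: b) -> (1 < size b)%N ->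
  uniq [seq [set e.1; e.2] | e <- cycle_pairs x b].
Proof.
move=> ub b1; rewrite map_cat cat_uniq (path_pairs_uniq ub).
set L := [seq _ | e <- path_pairs _]; rewrite /= orbF andbT {}/L.
case: b ub b1 => [|y [|z b]] // /and3P[xb yb ub] _.
have lb : last z b \in z :: b by exact: mem_last.
rewrite [last _ _]/= path_pairs_cons map_cons inE negb_or; apply/andP; split.
  apply/eqP => /set2_eq[[/= E _]|[/= E _]].
    by move: xb; rewrite -E !inE -in_cons lb orbT.
  by move: yb; rewrite -E lb.
apply/mapP => -[e /path_pairs_mem/andP[e1 e2] eE].
have : x \in [set e.1; e.2] by rewrite -eE set22.
by rewrite !inE => /orP[/eqP xE|/eqP xE]; move: xb; rewrite xE ?e1 ?e2.
Qed.

Lemma cycle_pairs_next x b u : u \in x :: b -> (u, next (x :: b) u) \in cycle_pairs x b.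
Proof.
suff gen x0 : u \in x :: b ->
    (u, next_at u x0 x b) \in path_pairs (x :: b) ++ [:: (last x b, x0)] by exact: gen.
elim: b x => [|y b IHb] x; first by rewrite inE => /eqP -> /=; rewrite eqxx inE.
rewrite path_pairs_cons cat_cons inE [next_at _ _ _ _]/=.
case: eqP => [->|_] /= ub; first by rewrite inE eqxx.
by rewrite inE IHb // orbT.
Qed.

Lemma cycle_pairs_mem x b e : e \in cycle_pairs x b -> (e.1 \in x :: b) && (e.2 \in x :: b).
Proof.
rewrite mem_cat => /orP[/path_pairs_mem //|]; rewrite inE => /eqP -> /=.
by rewrite mem_last mem_head.
Qed.

Lemma next_cycle_pairs x b e : uniq (x :: b) -> e \in cycle_pairs x b ->
  next (x :: b) e.1 = e.2.
Proof.
suff gen x0 : uniq (x :: b) -> e \in path_pairs (x :: b) ++ [:: (last x b, x0)] ->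
    next_at e.1 x0 x b = e.2 by exact: gen.
elim: b x => [|y b IHb] x; first by rewrite inE => _ /eqP -> /=; rewrite eqxx.
rewrite path_pairs_cons cat_cons inE [next_at _ _ _ _]/= => /andP[xb ub].
case/orP=> [/eqP-> /=|eP]; first by rewrite eqxx.
suff e1 : e.1 \in y :: b by case: eqP => [xE|_]; [rewrite -xE e1 in xb | exact: IHb].
move: eP; rewrite mem_cat inE => /orP[/path_pairs_mem/andP[] //|/eqP->].
exact: (mem_last y b).
Qed.

Lemma cycle_adjP x b u v : uniq (x :: b) ->
  cycle_adj (x :: b) u v = ((u, v) \in cycle_pairs x b) || ((v, u) \in cycle_pairs x b).
Proof.
move=> ub; apply/and3P/orP.
  by case=> uP vP /orP[/eqP <-|/eqP <-]; [left | right]; exact: cycle_pairs_next.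
case=> uv; have /andP[eu ev] := cycle_pairs_mem uv; split=> //.
  by apply/orP; left; apply/eqP; exact: next_cycle_pairs ub uv.
by apply/orP; right; apply/eqP; exact: next_cycle_pairs ub uv.
Qed.

End Cycles.

(** The orbit consists of distinct directed edges of the tree, and only one directed edge leaves a
    given leaf. *)
Lemma leaf_order_uniq (T : finType) (t : sgraph T) (rho : T -> {perm T}) d :
    rotation_system t rho -> t d.1 d.2 ->
  uniq (leaf_order t rho d) /\ {in leaf_order t rho d, forall v, leaf t v}.
Proof.
move=> rot td.
have orb e : e \in fingraph.orbit (face_step rho) d -> t e.1 e.2.
  move/trajectP=> [i _ ->]; elim: i => //= i IHi.
  move: (iter _ _ _) IHi => -[u v] /= uv.
  have vu : t v u by rewrite adj_sym.
  have /setP/(_ (rho v u)) := rot _ _ vu.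
  by rewrite inE => <-; have := mem_porbit (rho v) 1 u; rewrite expg1.
split; last first.
  by move=> v /mapP[e]; rewrite mem_filter => /andP[le _] ->.
rewrite map_inj_in_uniq ?filter_uniq ?orbit_uniq // => -[a b] [a' b'].
rewrite !mem_filter /= => /andP[la /orb /= ab] /andP[_ /orb /= a'b'] aa'.
by move: a'b'; rewrite -aa' => ab'; rewrite (leaf_nbr la ab ab').
Qed.

(** * The columns for a Halin graph, and the theorem *)

Section Halin.
Variables (R : realType) (T : finType) (G t : sgraph T) (x : T) (b : seq T).
Hypotheses (tree : is_tree t) (ub : uniq (x :: b)) (b_gt1 : (1 < size b)%N).
Hypothesis leaves : {in x :: b, forall v, leaf t v}.
Hypothesis GE : forall u v, G u v = t u v || cycle_adj (x :: b) u v.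
Let y := last x b.

Lemma halin_columns (o : orientation G) :
  exists2 s : {ffun 'I_#|{: edge G}| -> 'I_#|{: T + edge G}|},
    injective s & per (colsub s (A_mx R o)) != 0.
Proof.
have yb : y \in x :: b by exact: mem_last.
have ly : leaf t y := leaves yb.
have [w wE] : exists w, nbr t y = [set w] by apply/cards1P.
have yw : t y w by have := set11 w; rewrite -wE inE.
(* Otherwise [y] and [w] would be adjacent leaves and hence the whole tree, but the cycle has at
   least three vertices. *)
have wb : w \notin x :: b.
  apply/negP => /leaves lw.
  have sub : {subset x :: b <= [:: y; w]}.
    by move=> z _; rewrite !inE; exact: adjacent_leaves tree ly lw yw.
  by have := uniq_leq_size ub sub; rewrite /= ltnS leqNgt b_gt1.
have [l [gl lt lV lE ll]] := tree_grows w tree.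
have la e : e \in l -> e.2 \notin x :: b.
  by move/ll => /orP[/eqP-> //|]; apply: contra => /leaves.
have lb : {subset x :: b <= [seq e.1 | e <- l]}.
  by move=> v vb; apply: lV; apply: contraNneq wb => <-.
pose l0 := l ++ cycle_pairs x b.
have Gl0 e : e \in l0 -> G e.1 e.2.
  rewrite mem_cat GE => /orP[/lt -> //|]; case: e => u v uv.
  by rewrite (cycle_adjP _ _ ub) uv orbT.
have ywG : [set y; w] \in edges G.
  by apply/imsetP; exists (y, w); rewrite // inE GE yw.
pose e0 : edge G := exist _ [set y; w] ywG.
(* The default [e0] never matters: [mkE] is only evaluated at pairs adjacent in [G]. *)
pose mkE (p : T * T) : edge G := insubd e0 [set p.1; p.2].
have mkEK p : G p.1 p.2 -> val (mkE p) = [set p.1; p.2].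
  by move=> pG; rewrite /mkE insubdK //; apply/imsetP; exists p; rewrite ?inE.
have l0_uniq : uniq [seq [set e.1; e.2] | e <- l0].
  rewrite map_cat cat_uniq (grows_edges_uniq gl) (cycle_pairs_uniq ub b_gt1) andbT /=.
  apply/hasPn => _ /mapP[e /cycle_pairs_mem/andP[e1 e2] ->].
  apply/negP => /mapP[e' /la e'2 /esym eE].
  have : e'.2 \in [set e.1; e.2] by rewrite -eE set22.
  by rewrite !inE => /orP[/eqP E|/eqP E]; move: e'2; rewrite E ?e1 ?e2.
have l0E : perm_eq [seq [set e.1; e.2] | e <- l0] [seq val e | e <- enum {: edge G}].
  apply: uniq_perm; rewrite // ?(map_inj_uniq val_inj) ?enum_uniq // => S.
  apply/mapP/mapP => [[e /Gl0 eG ->]|[[S' SG] _ /= ->]].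
    by exists (mkE e); rewrite ?mem_enum // mkEK.
  case/imsetP: (SG) => -[u v]; rewrite inE /= GE (cycle_adjP _ _ ub) => uvG ->.
  have : ((u, v) \in l0) || ((v, u) \in l0).
    rewrite ![_ \in l ++ _]mem_cat; case/orP: uvG => [/lE /orP[] ->|/orP[] ->]; rewrite ?orbT //.
  by case/orP => ?; [exists (u, v) | exists (v, u); rewrite // setUC].
have sizeE : #|{: edge G}| = size l0.
  by rewrite cardE -(size_map val) -(perm_size l0E) size_map.
(* All vertices but the root [w], and all cycle edges but the closing one: one column fewer than
   there are edges. *)
pose zs : seq (T + edge G) :=
  map inl [seq e.1 | e <- l] ++ map inr [seq mkE e | e <- path_pairs (x :: b)].
have pG e : e \in path_pairs (x :: b) -> G e.1 e.2.
  by move=> eP; apply: Gl0; rewrite !mem_cat eP orbT.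
have wl : w \notin [seq e.1 | e <- l].
  by apply/negP; case/andP: (grows_fst gl) => _ /allP H /H; rewrite /= set11.
have zs_uniq : uniq zs.
  rewrite cat_uniq (map_inj_uniq (f := inl)); last by move=> ? ? [].
  rewrite (map_inj_uniq (f := inr)); last by move=> ? ? [].
  have /andP[-> _] := grows_fst gl; rewrite /=; apply/andP; split.
    by apply/hasPn => _ /mapP[e _ ->]; apply/negP => /mapP[].
  rewrite -(map_inj_uniq val_inj) -map_comp.
  have -> : map (val \o mkE) (path_pairs (x :: b)) =
      [seq [set e.1; e.2] | e <- path_pairs (x :: b)].
    by apply/eq_in_map => e /pG eG; rewrite /= mkEK.
  exact: path_pairs_uniq.
have zs_size : (size zs).+1 = #|{: edge G}|.
  rewrite sizeE !size_cat !size_map /= addn1 addnS.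
  by [].
have prodE : \prod_(z <- zs) col_form R z =
    (\prod_(e <- l) pvar R e.1) *
    \prod_(e <- path_pairs (x :: b)) (pvar R e.1 + pvar R e.2).
  rewrite big_cat !big_map /=; congr (_ * _); apply: eq_big_seq => e /pG eG.
  rewrite mkEK // big_setU1 ?big_set1 // inE.
  by apply: contraTneq eG => ->; rewrite adj_irr.
have formE : pvar R y * \prod_(z <- zs) col_form R z =
    (\prod_(e <- l | e.1 \notin x :: b) pvar R e.1) * path_form R (x :: b).
  rewrite prodE path_formE (bigID (fun e => e.1 \notin x :: b) predT) /=.
  have -> : \prod_(e <- l | ~~ (e.1 \notin x :: b)) pvar R e.1 =
      \prod_(v <- x :: b) pvar R v.
    rewrite [RHS](perm_big [seq v <- [seq e.1 | e <- l] | v \in x :: b]) /=.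
      by rewrite big_filter big_map; apply: eq_bigl => e; rewrite negbK.
    apply: uniq_perm; rewrite ?filter_uniq //; first by case/andP: (grows_fst gl).
    by move=> v; rewrite mem_filter; case: (boolP (v \in x :: b)) => // /lb ->.
  rewrite -/y; ring.
(* Neither of these two columns belongs to [zs], so either one completes it to distinct columns, and
   at least one of the two values is nonzero. *)
have diffE : col_form R (inr (mkE (y, w))) - col_form R (inl w : T + edge G) = pvar R y.
  rewrite /= mkEK ?GE ?yw // big_setU1 ?big_set1 ?addrK // inE.
  by apply: contraNneq wb => /= <-.
have b0 : b != [::] by apply: contraTneq b_gt1 => ->.
have := ediffs_halin_neq0 R ub b0 gl la lb.
rewrite -/l0 -formE -diffE mulrBl ediffsB mcoeffB.
have [e_eq0|e_neq0 _] := eqVneq (ediffs l0 (col_form R (inr (mkE (y, w))) *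
  \prod_(z <- zs) col_form R z))@_0 0; last first.
  apply: (per_columns o (inl w) (zs := inr (mkE (y, w)) :: zs) l0E);
    rewrite ?big_cons //= zs_uniq andbT.
  rewrite mem_cat negb_or; apply/andP; split; first by apply/negP => /mapP[].
  apply/mapP => -[f /mapP[e eP ->] [/(congr1 val)]]; rewrite (mkEK e (pG e eP)) mkEK ?GE ?yw // => E.
  have /path_pairs_mem/andP[e1 e2] := eP.
  have : w \in [set e.1; e.2] by rewrite -E set22.
  by rewrite !inE => /orP[/eqP wE'|/eqP wE']; move: wb; rewrite wE' ?e1 ?e2.
rewrite e_eq0 sub0r oppr_eq0 => w_neq0.
apply: (per_columns o (inl w) (zs := inl w :: zs) l0E);
  rewrite ?big_cons //= zs_uniq andbT.
rewrite mem_cat negb_or; apply/andP; split; last by apply/negP => /mapP[].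
by apply: contra wl => /mapP[v vl [->]].
Qed.
End Halin.

Theorem corollary4 (R : realType) (T : finType) (G : sgraph T)
    (HG : halin G) :
  (forall o : orientation G, pind (A_mx R o) = Some 1%N) /\
  choosable R G 2 2.
Proof.
case: HG => t [rho [d [tree _ rot td [c_size GE]]]].
have [uc leaves] := leaf_order_uniq rot td.
case: (leaf_order t rho d) uc leaves c_size GE => // x b ub leaves b_gt1 GE.
have columns := halin_columns R tree ub b_gt1 leaves GE.
have dG : [set d.1; d.2] \in edges G.
  by apply/imsetP; exists d; rewrite // inE GE td.
split=> [o|].
  have [s s_inj s_per] := columns o.
  by apply: pind_eq1 s_inj s_per; exists [set d.1; d.2].
(* Choosability mentions no orientation, so one is made by naming the two ends of each edge. *)
have ends (e : edge G) : exists uv : T * T, val e = [set uv.1; uv.2].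
  by case/imsetP: (valP e) => uv _ ->; exists uv.
have [f fE] := choice ends.
have [s s_inj s_per] := columns (Orientation fE).
exact: choosable22 s_inj s_per.
Qed.
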